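(* Let $\mathfrak{B}$ be a bornology with a closed base $\mathfrak{B}_0$ on a topological space $X$. The following hold. (1) If $|\mathfrak{B}_0|<\mathfrak{d}$, then $X$ satisfies $S_1(\Gamma_{\mathfrak{B}},\mathcal{O}_{\mathfrak{B}})$. (2) If $|\mathfrak{B}_0|<\mathfrak{d}$, then $X$ satisfies $U_{fin}(\Gamma_{\mathfrak{B}},\mathcal{O}_{\mathfrak{B}})$.
   Context: A bornology $\mathfrak{B}$ on $X$ is a family of subsets of $X$ that is closed under taking subsets and finite unions and covers $X$; by standing convention $X\notin\mathfrak{B}$. A base of $\mathfrak{B}$ is a subfamily $\mathfrak{B}_0\subseteq\mathfrak{B}$ such that every $B\in\mathfrak{B}$ is contained in some $B_0\in\mathfrak{B}_0$; it is closed if its members are closed subsets of $X$. $\mathcal{O}_{\mathfrak{B}}$ is the collection of all open $\mathfrak{B}$-covers of $X$: families $\mathcal{U}$ of open subsets of $X$ with $X\notin\mathcal{U}$ such that every $B\in\mathfrak{B}$ is contained in some $U\in\mathcal{U}$. $\Gamma_{\mathfrak{B}}$ is the collection of all $\gamma_{\mathfrak{B}}$-covers of $X$: infinite covers $\mathcal{U}=\{U_n:n\in\omega\}$ of $X$ by proper open subsets such that for each $B\in\mathfrak{B}$ there is $n_0\in\omega$ with $B\subseteq U_n$ for all $n\ge n_0$. $S_1(\mathcal{A},\mathcal{B})$ means that for each sequence $\{\mathcal{U}_n:n\in\omega\}$ of elements of $\mathcal{A}$ there are $V_n\in\mathcal{U}_n$ with $\{V_n:n\in\omega\}\in\mathcal{B}$.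 $U_{fin}(\mathcal{A},\mathcal{B})$ means that for each such sequence there are finite (possibly empty) $\mathcal{V}_n\subseteq\mathcal{U}_n$ such that $\{\bigcup\mathcal{V}_n:n\in\omega\}\in\mathcal{B}$ or $\bigcup\mathcal{V}_n=X$ for some $n$. $\mathfrak{d}$ is the least cardinality of a dominating $D\subseteq\omega^\omega$, i.e. one such that for each $g\in\omega^\omega$ there is $f\in D$ with $g(n)\le f(n)$ for all but finitely many $n$. *)

(* Defs.v *)
From mathcomp Require Import all_boot.
From mathcomp Require Import boolp classical_sets functions cardinality.
From mathcomp Require Import topology.

Set Implicit Arguments.
Unset Strict Implicit.
Unset Printing Implicit Defensive.

Local Open Scope classical_set_scope.
Local Open Scope card_scope.

Definition card_lt (T U : Type) (A : set T) (B : set U) : Prop :=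
  (A #<= B) /\ ~ (B #<= A).

(* Minimum of a nonempty family of cardinals.  A maximal set of choice
   functions that pairwise differ at every member of [F] projects onto some
   member of [F], which then injects into all the others. *)
Lemma ex_least_card (T : Type) (F : set (set T)) : F !=set0 ->
  exists2 D, F D & forall E, F E -> D #<= E.
Proof.
move=> [D1 FD1].
pose P (S : set (set T -> T)) :=
  (forall x, S x -> forall D, F D -> D (x D)) /\
  (forall x y, S x -> S y -> forall D, F D -> x D = y D -> x = y).
have [S [[PS1 PS2] Smax]] : exists S, P S /\ forall S', S `<` S' -> ~ P S'.
  apply: Zorn_bigcup => C CP Ctot; split.
    by move=> x [S CS Sx] D FD; exact: (CP _ CS).1 x Sx D FD.
  move=> x y [S CS Sx] [S' CS' S'y] D FD xy.
  have [SS'|S'S] := Ctot _ _ CS CS'.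
    by apply: (CP _ CS').2 FD xy => //; exact: SS'.
  by apply: (CP _ CS).2 FD xy => //; exact: S'S.
have [D [FD Dsurj]] : exists D, F D /\ forall a, D a -> exists2 x, S x & x D = a.
  apply: contrapT => /forallNP nD.
  have new D : exists a, F D -> D a /\ forall x, S x -> x D <> a.
    have [FD|nFD] := pselect (F D); last first.
      have [[a _]|/forallNP nT] := pselect (exists a : T, True).
        by exists a => /nFD.
      case: (nD D1); split=> // a; by case: (nT a).
    have /not_andP[//|/existsNP[a /not_implyP[Da na]]] := nD D.
    by exists a => _; split=> // x Sx xD; apply: na; exists x.
  have {new}[z zP] := choice new.
  have nSz : ~ S z by move=> Sz; exact: ((zP D1 FD1).2 z Sz).
  apply: (Smax (S `|` [set z])).
    split; first by move=> x Sx; left.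
    by move=> /(_ z) h; apply/nSz/h; right.
  split.
    by move=> x [Sx|->] D FD; [exact: PS1 FD | exact: (zP D FD).1].
  move=> x y [Sx|->] [Sy|->] D FD // xy.
  - exact: PS2 FD xy.
  - by case: ((zP D FD).2 x Sx).
  - by case: ((zP D FD).2 y Sy).
exists D => // E FE.
have : forall a, exists x, D a -> S x /\ x D = a.
  move=> a; have [/Dsurj[x Sx xa]|nDa] := pselect (D a); first by exists x.
  by exists (fun=> a).
move=> /choice[g gP].
have ginj : {in D &, injective (g ^~ E)}.
  move=> a b /set_mem Da /set_mem Db gab.
  have [[Sa <-] [Sb <-]] := (gP a Da, gP b Db).
  by rewrite (PS2 _ _ Sa Sb E FE gab).
apply: (@card_le_trans _ _ _ ((g ^~ E) @` D)).
  by have /card_eqPle[] := inj_card_eq ginj.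
apply: subset_card_le => _ [a Da <-]; exact: PS1 (gP a Da).1 E FE.
Qed.

Definition dominating (D : set (nat -> nat)) : Prop :=
  forall g : nat -> nat, exists2 f, D f & \forall n \near \oo, g n <= f n.

Lemma ex_least_dominating : exists D, dominating D /\
  forall E, dominating E -> D #<= E.
Proof.
have [|D domD Dmin] := @ex_least_card _ dominating; last by exists D.
by exists setT => g; exists g => //; exact: nearW.
Qed.

(* Cardinals are not objects here: [frak_d] is a dominating family of least
   cardinality, whose cardinality is therefore the dominating number. *)
Definition frak_d : set (nat -> nat) := sval (cid ex_least_dominating).

Lemma frak_dP : dominating frak_d /\ forall E, dominating E -> frak_d #<= E.
Proof. exact: svalP (cid ex_least_dominating). Qed.

Definition bornology (X : Type) (B : set (set X)) : Prop :=
  [/\ forall A A', A `<=` A' -> B A' -> B A,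
      forall F : set (set X), finite_set F -> F `<=` B -> B (\bigcup_(A in F) A),
      \bigcup_(A in B) A = setT
    & ~ B setT].

Definition bornology_base (X : Type) (B B0 : set (set X)) : Prop :=
  B0 `<=` B /\ forall A, B A -> exists2 A0, B0 A0 & A `<=` A0.

Definition closed_base (X : topologicalType) (B B0 : set (set X)) : Prop :=
  bornology_base B B0 /\ B0 `<=` closed.

Definition open_B_covers (X : topologicalType) (B : set (set X)) :
    set (set (set X)) :=
  [set U | [/\ U `<=` open, ~ U setT
    & forall A, B A -> exists2 V, U V & A `<=` V]].

Definition gamma_B_covers (X : topologicalType) (B : set (set X)) :
    set (set (set X)) :=
  [set U | [/\ infinite_set U, \bigcup_(V in U) V = setT,
      U `<=` open, ~ U setT
    & exists2 u : nat -> set X, U = range u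
      & forall A, B A -> exists n0, forall n, n0 <= n -> A `<=` u n]].

Definition S1 (X : Type) (AA BB : set (set (set X))) : Prop :=
  forall U : nat -> set (set X), (forall n, AA (U n)) ->
  exists2 V : nat -> set X, forall n, U n (V n) & BB (range V).

Definition Ufin (X : Type) (AA BB : set (set (set X))) : Prop :=
  forall U : nat -> set (set X), (forall n, AA (U n)) ->
  exists2 V : nat -> set (set X),
    forall n, finite_set (V n) /\ V n `<=` U n &
    BB (range (fun n => \bigcup_(A in V n) A)) \/
    exists n, \bigcup_(A in V n) A = setT.

(* Main.v *)
Require Import Defs.
From mathcomp Require Import all_boot.
From mathcomp Require Import boolp classical_sets functions cardinality.
From mathcomp Require Import topology.

(** Enumerate the [n]-th gamma-cover as [u n 0, u n 1, ...].  Each bounded set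
    [A] has a modulus [f A : nat -> nat]: it lies in [u n m] as soon as
    [f A n <= m].  A choice of one member [u n (g n)] per cover catches [A]
    whenever [f A n < g n] for a single [n].  The moduli of the members of a
    base with fewer than [frak_d] elements do not dominate, so one [g] escapes
    all of them and its choice is an open cover in the required sense
    ([not_dominating_image], [gamma_open_S1]).  The statement on finite
    selections follows by selecting singletons ([S1_Ufin]). *)

Local Open Scope classical_set_scope.
Local Open Scope card_scope.

(** If the image of [A] dominated, minimality would give
    [frak_d #<= f @` A #<= A].  A function [g] that the image fails to dominate
    exceeds each [f a] infinitely often; one place is enough for a selection
    that only has to catch each bounded set once. *)
Lemma not_dominating_image (T : Type) (A : set T) (f : T -> nat -> nat) :
  card_lt A frak_d -> exists g, forall a, A a -> exists n, f a n < g n.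
Proof.
move=> [_ nle].
have ndom : ~ dominating (f @` A).
  move=> dom; apply: nle.
  exact: card_le_trans (frak_dP.2 _ dom) (card_image_le f A).
have /existsNP[g gP] := ndom.
exists g => a Aa; apply: contrapT => /forallNP nlt.
apply: gP; exists (f a); first by exists a.
by apply: nearW => n; rewrite leqNgt; apply/negP; exact: nlt.
Qed.

(** Members of a gamma-cover beyond the modulus of [A0] contain [A0], so it
    suffices that the index selected in one cover exceeds that modulus; sets
    inside [A0] are then caught as well, hence moduli of base members
    decide. *)
Lemma gamma_open_S1 (X : topologicalType) (B B0 : set (set X)) :
  bornology_base B B0 -> card_lt B0 frak_d ->
  S1 (gamma_B_covers B) (open_B_covers B).
Proof.
move=> [B0B baseB] B0lt U UG.
have /choice[u uP] n : exists v : nat -> set X, U n = range v /\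
    forall A, B A -> exists n0, forall m, n0 <= m -> A `<=` v m.
  by have [_ _ _ _ [v ? ?]] := UG n; exists v.
have modulus (A : set X) : exists f : nat -> nat,
    B A -> forall n m, f n <= m -> A `<=` u n m.
  have [BA|nBA] := pselect (B A); last by exists (fun=> 0).
  by have /choice[f fP] := fun n => (uP n).2 A BA; exists f.
have [f fP] := choice modulus.
have [g gP] := not_dominating_image _ _ f B0lt.
have Uug n : U n (u n (g n)) by rewrite (uP n).1; exists (g n).
exists (fun n => u n (g n)) => //; split.
- by move=> _ [n _ <-]; have [_ _ + _ _] := UG n; apply.
- by move=> [n _ unT]; have [_ _ _ + _] := UG n; apply; rewrite -unT.
- move=> A /baseB[A0 B0A0 AA0]; have [n fg] := gP _ B0A0.
  exists (u n (g n)); first by exists n.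
  by apply: subset_trans AA0 _; apply: fP (ltnW fg) => //; exact: B0B.
Qed.

Lemma S1_Ufin (X : Type) (AA BB : set (set (set X))) :
  S1 AA BB -> Ufin AA BB.
Proof.
move=> S1AB U UA; have [V UV BV] := S1AB U UA.
exists (fun n => [set V n]).
  by move=> n; split; [exact: finite_set1 | move=> _ ->].
left; suff -> : (fun n => \bigcup_(A in [set V n]) A) = V by [].
by apply/funext => n; rewrite bigcup_set1.
Qed.

Theorem theorem4p14 (X : topologicalType) (B B0 : set (set X))
    (hB : bornology B) (hB0 : closed_base B B0) :
  (card_lt B0 frak_d -> S1 (gamma_B_covers B) (open_B_covers B)) /\
  (card_lt B0 frak_d -> Ufin (gamma_B_covers B) (open_B_covers B)).
Proof.
have [baseB _] := hB0.
by split=> B0lt; [|apply: S1_Ufin]; exact: gamma_open_S1 baseB B0lt.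
Qed.
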